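(* Let $Y\ge0$ be a random variable with mean $\mu$ and variance $\sigma^2\in(0,\infty)$, and let $Y^s$ be a random variable defined on the same probability space as $Y$ and having the $Y$-size biased distribution. If $P[|Y^s-Y|\le B]=1$ for some constant $B>0$, then $$D_Y\;\le\;\frac{\mu}{5\sigma^2}\left(\sqrt{\frac{11B^2}{\sigma}+5\Delta}+\frac{2B}{\sqrt\sigma}\right)^2,$$ where $\Delta:=\sqrt{\operatorname{Var}\bigl(\mathbb{E}[Y^s-Y\mid Y]\bigr)}$.
   Context: For a nonnegative random variable $Y$ with mean $\mu=\mathbb{E}Y\in(0,\infty)$, a random variable $Y'$ has the $Y$-size biased distribution if $\mathbb{E}[Yg(Y)]=\mu\,\mathbb{E}[g(Y')]$ for all bounded continuous functions $g:\mathbb{R}\to\mathbb{R}$. For a random variable $X$ with $\operatorname{SD}(X):=\sqrt{\operatorname{Var}(X)}\in(0,\infty)$, $$D_X:=\sup_{t\in\mathbb{R}}\left|P\left[\frac{X-\mathbb{E}X}{\operatorname{SD}(X)}\le t\right]-P[Z\le t]\right|,$$ where $Z$ is a standard normal random variable. *)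

(* Defs.v *)
From HB Require Import structures.
From mathcomp Require Import all_boot all_order all_algebra.
From mathcomp Require Import all_classical all_reals all_analysis.

Set Implicit Arguments.
Unset Strict Implicit.
Unset Printing Implicit Defensive.

Import Order.TTheory GRing.Theory Num.Theory.
Import numFieldNormedType.Exports.

Local Open Scope classical_set_scope.
Local Open Scope ring_scope.

(* Y' may live on a probability space of its own. Meant for Y nonnegative with
   mean in ]0, +oo[, so that both sides are finite. *)
Definition size_biased d d' (T : measurableType d) (T' : measurableType d')
    (R : realType) (P : probability T R) (P' : probability T' R)
    (Y : {RV P >-> R}) (Y' : {RV P' >-> R}) : Prop :=
  forall g : R -> R, continuous g -> bounded_fun g ->
    ('E_P[(fun w => Y w * g (Y w))%R] =
     'E_P[Y] * 'E_P'[(fun w => g (Y' w))])%E.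

Definition std_dev d (T : measurableType d) (R : realType)
    (P : probability T R) (X : T -> R) : R :=
  Num.sqrt (fine 'V_P[X]).

(* The real supremum is legitimate: the set is nonempty and bounded by 1. *)
Definition normal_distance d (T : measurableType d) (R : realType)
    (P : probability T R) (X : {RV P >-> R}) : R :=
  sup [set `| fine (P [set w | (X w - fine 'E_P[X]) / std_dev P X <= t])
             - fine (normal_prob 0 1 `]-oo, t]) | | t in [set: R]].

(* h is a version of E[X | Y], for X integrable. *)
Definition is_cond_expectation d (T : measurableType d) (R : realType)
    (P : probability T R) (X : T -> R) (Y : {RV P >-> R}) (h : T -> R) : Prop :=
  [/\ measurable_fun [set: g_sigma_algebra_preimageType Y]
        (h : g_sigma_algebra_preimageType Y -> R),
      P.-integrable [set: T] (EFin \o h) &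
      forall A : set T, g_sigma_algebra_preimage Y A ->
        (\int[P]_(w in A) (h w)%:E = \int[P]_(w in A) (X w)%:E)%E].

Arguments size_biased {d d' T T' R} P P' Y Y'.
Arguments std_dev {d T R} P X.
Arguments normal_distance {d T R} P X.
Arguments is_cond_expectation {d T R} P X Y h.

(* Main.v *)
Require Import Defs.
From HB Require Import structures.
From mathcomp Require Import all_boot all_order all_algebra.
From mathcomp Require Import all_classical all_reals all_analysis.
From mathcomp Require Import measurable_realfun.
From mathcomp Require Import ring lra.
Import Order.TTheory GRing.Theory Num.Theory.
Import numFieldNormedType.Exports.
Local Open Scope classical_set_scope.
Local Open Scope ring_scope.

(** Stein's method, run with a smoothed half-line whose width is optimised at
    the end.

    Put W = (Y - mu) / sigma, U = (Y^s - Y) / sigma, lambda = mu / sigma and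
    b = B / sigma.  Size biasing turns into the Stein identity
      E[W f(W)] = lambda E[f(W + U) - f(W)],
    and, applied to f(w) = w through truncations
    ([size_bias_second_moment]), into lambda E[U] = 1; in particular
    1 <= lambda b ([size_bias_gap]).

    Let h be the ramp equal to 1 on the left of t and to 0 on the right of
    t + a, let N be its Gaussian mean and f the solution of
    f'(w) - w f(w) = h(w) - N.  The identity gives
      E h(W) - N = E[f'(W) (1 - lambda U)] - lambda E[rem],
      rem = f(W + U) - f(W) - U f'(W).
    Only E[U | Y] matters in the first term, whose mean is 1 / lambda, so that
    |f'| <= 1 ([dstein_le1]) bounds it by lambda SD(E[U | Y]).  Since also
    0 <= f <= 1 ([stein_ge0], [stein_le1]), the function f' is Lipschitz at w
    with constant 1 + |w|, plus 1 / a when w is within b of the ramp; hence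
      |rem| <= (b^2 / 2) (1 + |W| + (1 / a) 1{t - b < W <= t + a + b})
    ([stein_ramp_taylor]).  Here E|W| <= 1, and the probability of the slab is
    at most 2 D + (a + 2 b) / 2, where D is the distance to be bounded and 1/2
    bounds the Gaussian density.  Replacing half-lines by ramps costs another
    a / 2, whence, for every a > 0 ([core_bound]),
      D <= a / 2 + lambda SD(E[U | Y])
           + lambda (b^2 / 2) (2 + (2 D + (a + 2 b) / 2) / a).

    With a = k lambda b^2 the unknown D reappears on the right only as D / k.
    Solving for D and choosing k gives the theorem ([smoothing_optimum]): the
    square of a sum of two square roots is what minimising an expression of
    the form k / (k - 1) * (c1 + c2 k) over k > 1 produces. *)

(** * Pointwise derivatives *)

Section pointwise_derivatives.
Context {R : realType}.
Implicit Types (f g : R -> R) (x : R).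

(** Derivation rules for functions written pointwise, so that they compose by
    unification with lambda-abstractions. *)
Lemma is_derive1_cst (c x : R) : is_derive x 1 (fun=> c) 0.
Proof. exact: is_derive_cst. Qed.

Lemma is_derive1_id (x : R) : is_derive x 1 (fun y => y) 1.
Proof. exact: is_derive_id. Qed.

Lemma is_derive1_eq {f x df df'} : is_derive x 1 f df -> df = df' ->
  is_derive x 1 f df'.
Proof. by move=> + <-. Qed.

Lemma is_derive1D {f g x df dg} : is_derive x 1 f df -> is_derive x 1 g dg ->
  is_derive x 1 (fun y => f y + g y) (df + dg).
Proof. exact: is_deriveD. Qed.

Lemma is_derive1B {f g x df dg} : is_derive x 1 f df -> is_derive x 1 g dg ->
  is_derive x 1 (fun y => f y - g y) (df - dg).
Proof. exact: is_deriveB. Qed.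

Lemma is_derive1M {f g x df dg} : is_derive x 1 f df -> is_derive x 1 g dg ->
  is_derive x 1 (fun y => f y * g y) (f x * dg + g x * df).
Proof. exact: is_deriveM. Qed.

Lemma is_derive1_div {f g x df dg} : g x != 0 ->
  is_derive x 1 f df -> is_derive x 1 g dg ->
  is_derive x 1 (fun y => f y / g y) (df / g x - f x * dg / g x ^+ 2).
Proof.
move=> gx0 Df Dg.
have DV : is_derive x 1 (fun y => (g y)^-1) (- dg / g x ^+ 2).
  have dg' : derivable g x 1 by case: Dg.
  split; first exact: derivableV.
  by rewrite (deriveV gx0 dg') derive_val /GRing.scale/= !mulNr mulrC.
apply: is_derive1_eq (is_derive1M Df DV) _.
by rewrite addrC; congr (_ + _); [rewrite mulrC|rewrite mulNr mulrN mulrA].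
Qed.

Lemma is_derive1_compose {f g x df dg} :
  is_derive (g x) 1 f df -> is_derive x 1 g dg ->
  is_derive x 1 (fun y => f (g y)) (df * dg).
Proof. by move=> Df Dg; exact: (@is_derive1_comp _ f g). Qed.

Lemma is_derive1_continuous {f} {df : R -> R} :
  (forall x, is_derive x 1 f (df x)) -> continuous f.
Proof.
move=> Df x; apply: differentiable_continuous; apply/derivable1_diffP.
by case: (Df x).
Qed.

Lemma derive_le0_le f (df : R -> R) (a b : R) :
  (forall x, is_derive x 1 f (df x)) ->
  a <= b -> (forall x, a < x < b -> df x <= 0) -> f b <= f a.
Proof.
move=> Df ab df0.
apply: (@ler0_derive1_le_cc _ f a b); rewrite ?in_itv/= ?lexx ?ab//.
- by move=> x; rewrite in_itv/= derive1E derive_val => xab; exact: df0.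
- exact/continuous_subspaceT/(is_derive1_continuous Df).
Qed.

End pointwise_derivatives.

(** * The standard normal density and distribution function *)

Section gauss.
Context {R : realType}.

Implicit Types (w x : R) (h : R -> R).

Definition gphi (x : R) : R := normal_pdf 0 1 x.

Lemma gphiE x : gphi x = normal_peak 1 * expR (- (x ^+ 2) / 2).
Proof.
rewrite /gphi normal_pdfE ?oner_neq0// /normal_fun subr0 expr1n.
by rewrite -(mulr_natr 1) mul1r.
Qed.

Lemma gphi_gt0 x : 0 < gphi x.
Proof. by rewrite gphiE mulr_gt0 ?expR_gt0// normal_peak_gt0// oner_neq0. Qed.

(** The crude bound 1/2 instead of 1 / sqrt (2 pi) is enough for the final
    constants. *)
Lemma gphi_le_half x : gphi x <= 1 / 2.
Proof.
apply: (@le_trans _ _ (normal_peak 1)).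
  by apply: normal_pdf_ub; exact: oner_neq0.
rewrite /normal_peak expr1n mul1r mul1r lef_pV2 ?posrE ?sqrtr_gt0//; last first.
  by rewrite mulrn_wgt0// pi_gt0.
rewrite -[leLHS]ger0_norm// -sqrtr_sqr ler_sqrt.
  by have := pi_ge2 R; lra.
by have := pi_ge2 R; lra.
Qed.

Lemma gphiN x : gphi (- x) = gphi x.
Proof. by rewrite !gphiE sqrrN. Qed.

Lemma is_derive_gphi (x : R) : is_derive x 1 gphi (- x * gphi x).
Proof.
have -> : gphi = (fun x => normal_peak 1 * expR (x * x * (- 2^-1))).
  by apply/funext => y; rewrite gphiE expr2 mulrN mulNr.
have Dsq : is_derive x 1 (fun y : R => y * y * (- 2^-1)) (- x).
  apply: is_derive1_eq (is_derive1M (is_derive1M (is_derive1_id x)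
    (is_derive1_id x)) (is_derive1_cst (- 2^-1) x)) _.
  by rewrite /=; field.
apply: is_derive1_eq (is_derive1M (is_derive1_cst (normal_peak 1) x)
  (is_derive1_compose (is_derive_expR _) Dsq)) _.
by rewrite /=; ring.
Qed.

Lemma continuous_gphi : continuous gphi.
Proof. exact: is_derive1_continuous is_derive_gphi. Qed.

Lemma measurable_gphi : measurable_fun setT gphi.
Proof. exact: measurable_normal_pdf. Qed.

(** Integrals of [h] against the standard normal law, over the two half-lines
    cut at [w]. *)
Definition gint (h : R -> R) (w : R) : R :=
  \int[lebesgue_measure]_(x in `]-oo, w]) (h x * gphi x).

Definition gtail (h : R -> R) (w : R) : R :=
  \int[lebesgue_measure]_(x in `]w, +oo[) (h x * gphi x).

Definition gPhi (w : R) : R := fine (normal_prob 0 1 `]-oo, w]).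

Lemma integrable_gphi (h : R -> R) (A : set R) : measurable A ->
  measurable_fun setT h -> (forall x, 0 <= h x <= 1) ->
  lebesgue_measure.-integrable A (fun x => (h x * gphi x)%:E).
Proof.
move=> mA mh h01; apply: (@integrableS _ _ _ _ setT) => //.
apply: (le_integrable _ _ _ (integrable_normal_pdf 0 1)) => //.
  by apply/measurable_EFinP; apply: measurable_funM => //; exact: measurable_gphi.
move=> x _; rewrite lee_fin; have /andP[h0 h1] := h01 x.
have p0 := ltW (gphi_gt0 x).
by rewrite !ger0_norm ?mulr_ge0// ler_piMl.
Qed.

Lemma is_derive_gint (h : R -> R) (w : R) : continuous h ->
  (forall x, 0 <= h x <= 1) -> is_derive w 1 (gint h) (h w * gphi w).
Proof.
move=> ch h01.
have mh : measurable_fun setT h by exact: continuous_measurable_fun.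
have [] := @continuous_FTC1 R (fun x => h x * gphi x) -oo%O w (w + 1).
- by rewrite ltrDl.
- exact: integrable_gphi.
- by rewrite ltNyr.
- by apply: cvgM; [exact: ch|exact: continuous_gphi].
by move=> D E; split => //; rewrite -derive1E.
Qed.

Lemma gPhiE w : gPhi w = gint (cst 1) w.
Proof.
rewrite /gPhi /gint /Rintegral /normal_prob; congr fine.
by apply: eq_integral => x _; rewrite /= mul1r.
Qed.

Lemma is_derive_gPhi w : is_derive w 1 gPhi (gphi w).
Proof.
have -> : gPhi = gint (cst 1) by apply/funext => x; exact: gPhiE.
rewrite -[gphi w]mul1r; apply: is_derive_gint => [x|x]; first exact: cvg_cst.
by rewrite ler01 lexx.
Qed.

Lemma gint_tail (h : R -> R) w :
  measurable_fun setT h -> (forall x, 0 <= h x <= 1) ->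
  \int[lebesgue_measure]_x (h x * gphi x) = gint h w + gtail h w.
Proof.
move=> mh h01; rewrite /gint /gtail -Rintegral_setU//.
- by congr Rintegral; rewrite -itv_bndbnd_setU// set_itvNyy.
- by apply: integrable_gphi => //; exact: measurableU.
- by apply: lt_disjoint => x y /=; rewrite !in_itv/= andbT => /le_lt_trans; apply.
Qed.

Lemma gPhi_ge0 w : 0 <= gPhi w.
Proof. exact: fine_ge0. Qed.

Lemma gtail1 w : gtail (cst 1) w = 1 - gPhi w.
Proof.
have h01 (x : R) : 0 <= (cst 1 x : R) <= 1 by rewrite ler01 lexx.
apply/eqP; rewrite eq_sym subr_eq addrC gPhiE -gint_tail//; apply/eqP.
rewrite /Rintegral; under eq_integral do rewrite /= mul1r.
by rewrite integral_normal_pdf.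
Qed.

Lemma gPhi_le1 w : gPhi w <= 1.
Proof.
rewrite -subr_ge0 -gtail1; apply: Rintegral_ge0 => x _.
by rewrite mul1r ltW// gphi_gt0.
Qed.

(** The identity, seen as a standard normal random variable, gives access to
    the limits of distribution functions. *)
Let gid : measurableTypeR R -> R := idfun.

#[local] HB.instance Definition _ :=
  @isMeasurableFun.Build _ _ _ _ gid (@measurable_id _ _ setT).

Lemma cvg_gPhi_pinfty : gPhi x @[x --> +oo] --> (1 : R).
Proof.
have := cvg_cdfy1 (gid : {RV (normal_prob 0 1 : probability _ R) >-> R}).
rewrite (_ : cdf _ = EFin \o gPhi); last first.
  by apply: funext => r; rewrite /= /gPhi fineK// fin_num_measure.
by move/fine_cvgP => [].
Qed.

Lemma cvg_gPhi_ninfty : gPhi x @[x --> -oo] --> (0 : R).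
Proof.
have := cvg_cdfNy0 (gid : {RV (normal_prob 0 1 : probability _ R) >-> R}).
rewrite (_ : cdf _ = EFin \o gPhi); last first.
  by apply: funext => r; rewrite /= /gPhi fineK// fin_num_measure.
by move/fine_cvgP => [].
Qed.

(** Passage to the limit at infinity in an inequality linear in [gPhi y]. *)
Lemma le_gPhi_pinfty (a c C : R) :
  (forall y, a <= y -> c * gPhi y <= C) -> c <= C.
Proof.
move=> H; have L : c * gPhi y @[y --> +oo] --> c.
  by rewrite -[X in _ --> X]mulr1; apply: cvgMl_tmp; exact: cvg_gPhi_pinfty.
rewrite -(cvg_lim _ L)//; apply: limr_le; first by apply/cvg_ex; exists c.
by near=> y; apply: H; near: y; apply: nbhs_pinfty_ge; exact: num_real.
Unshelve. all: by end_near. Qed.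

Lemma gPhi_lip x y : x <= y -> 0 <= gPhi y - gPhi x <= (y - x) / 2.
Proof.
move=> xy; apply/andP; split.
  rewrite subr_ge0 -lerN2 -[leLHS]add0r -[leRHS]add0r.
  apply: (@derive_le0_le _ (fun z => 0 - gPhi z) (fun z => 0 - gphi z)) => // z.
    apply: is_derive1B (is_derive1_cst _ _) (is_derive_gPhi z).
  by rewrite sub0r oppr_le0 ltW// gphi_gt0.
suff : gPhi y - y / 2 <= gPhi x - x / 2 by lra.
apply: (@derive_le0_le _ (fun z => gPhi z - z / 2)
  (fun z => gphi z - 1 / 2)) => // z; last by rewrite subr_le0 gphi_le_half.
apply: is_derive1B (is_derive_gPhi z) _.
apply: is_derive1_eq (is_derive1M (is_derive1_id z) (is_derive1_cst 2^-1 z)) _.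
by rewrite /=; ring.
Qed.

Lemma gPhiN x : gPhi (- x) = 1 - gPhi x.
Proof.
(* The derivative of s vanishes, and s tends to 1. *)
pose s y : R := gPhi y + gPhi (- y).
have DN (y : R) : is_derive y 1 (fun z : R => - z) (-1).
  exact: is_deriveNid.
have s_cst y : s y = s x.
  apply: is_derive_0_is_cst => z.
  apply: is_derive1_eq (is_derive1D (is_derive_gPhi z)
    (is_derive1_compose (is_derive_gPhi (- z)) (DN z))) _.
  by rewrite gphiN; ring.
have L : s y @[y --> +oo] --> (1 + 0 : R).
  apply: cvgD; first exact: cvg_gPhi_pinfty.
  by have := cvg_gPhi_ninfty; rewrite cvgNy_compNP.
have : s y @[y --> +oo] --> s x.
  by rewrite (_ : s = cst (s x)); [exact: cvg_cst|apply/funext].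
move=> /(cvg_unique _ L); rewrite addr0 /s => E; have := E (@Rhausdorff R); lra.
Qed.

(** Mills' ratio bound: [w * gPhi y + gphi y] is nonincreasing in [y >= w],
    because its derivative is [(w - y) * gphi y]. *)
Lemma mills w : w * (1 - gPhi w) <= gphi w.
Proof.
suff : w <= w * gPhi w + gphi w by lra.
apply: (@le_gPhi_pinfty w) => y wy.
apply: (@le_trans _ _ (w * gPhi y + gphi y)).
  by rewrite lerDl ltW// gphi_gt0.
apply: (@derive_le0_le _ (fun y => w * gPhi y + gphi y)
  (fun y => (w - y) * gphi y)) => // z.
  apply: is_derive1_eq (is_derive1D (is_derive1M (is_derive1_cst w z)
    (is_derive_gPhi z)) (is_derive_gphi z)) _.
  by rewrite /=; ring.
by move=> /andP[wz _]; rewrite pmulr_lle0 ?gphi_gt0// subr_le0 ltW.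
Qed.

Lemma millsN w : - w * gPhi w <= gphi w.
Proof. by have := mills (- w); rewrite gphiN gPhiN subKr. Qed.

(** The function [gphi - gPhi * (1 - gPhi)] tends to 0 and is nonincreasing on
    the positive half-line, its derivative being [gphi y * (2 gPhi y - 1 - y)]
    where [2 gPhi y - 1 <= y]; negative arguments follow by symmetry. *)
Lemma gPhi_onem_le w : gPhi w * (1 - gPhi w) <= gphi w.
Proof.
wlog w0 : w / 0 <= w.
  move=> H; have [/H//|/ltW w0] := leP 0 w.
  have := H (- w); rewrite gphiN gPhiN subKr mulrC; apply.
  by rewrite oppr_ge0.
pose G y := gphi y - gPhi y * (1 - gPhi y).
suff : 1 <= 1 + G w by rewrite lerDl subr_ge0.
apply: (@le_gPhi_pinfty w) => y wy; rewrite mul1r.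
apply: (@le_trans _ _ (1 + G y)).
  have := gphi_gt0 y; have := gPhi_ge0 y; have := gPhi_le1 y; rewrite /G; nra.
rewrite lerD2l.
apply: (@derive_le0_le _ G (fun y => gphi y * (2 * gPhi y - 1 - y))) => // z.
  apply: is_derive1_eq (is_derive1B (is_derive_gphi z)
    (is_derive1M (is_derive_gPhi z)
      (is_derive1B (is_derive1_cst 1 z) (is_derive_gPhi z)))) _.
  by rewrite /=; ring.
move=> /andP[wz _]; rewrite pmulr_rle0 ?gphi_gt0//.
have z0 : 0 <= z by rewrite (le_trans w0)// ltW.
have /andP[_] := gPhi_lip 0 z z0.
by have := gPhiN 0; rewrite oppr0; lra.
Qed.

End gauss.

(** * The Stein equation *)

Section stein.
Context {R : realType} {h : R -> R}.
Hypothesis ch : continuous h.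
Hypothesis h_noninc : {homo h : x y /~ x <= y}.
Hypothesis h01 : forall x, 0 <= h x <= 1.
Implicit Types (w x : R).

Definition gmean (k : R -> R) : R :=
  \int[lebesgue_measure]_x (k x * gphi x).

(** Bounded solution of [f' w - w * f w = h w - N] for [N] the Gaussian mean of
    [h]. *)
Definition stein (k : R -> R) (w : R) : R :=
  (gint k w - gmean k * gPhi w) / gphi w.

(** The derivative of [stein k], as given by the equation that it solves. *)
Definition dstein (k : R -> R) (w : R) : R := w * stein k w + k w - gmean k.

Let mh : measurable_fun setT h.
Proof. exact: continuous_measurable_fun. Qed.

Lemma is_derive_stein w : is_derive w 1 (stein h) (dstein h w).
Proof.
have p0 : gphi w != 0 by rewrite gt_eqF// gphi_gt0.
apply: is_derive1_eq (is_derive1_div p0 (is_derive1B (is_derive_gint h w ch h01)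
  (is_derive1M (is_derive1_cst (gmean h) w) (is_derive_gPhi w)))
  (is_derive_gphi w)) _.
by rewrite /dstein /stein /=; field.
Qed.

Lemma continuous_stein : continuous (stein h).
Proof. exact: is_derive1_continuous is_derive_stein. Qed.

Lemma continuous_dstein : continuous (dstein h).
Proof.
move=> w; apply: cvgB; last exact: cvg_cst.
by apply: cvgD; [apply: cvgM; [exact: cvg_id|exact: continuous_stein]|exact: ch].
Qed.

Lemma gint_ge w : h w * gPhi w <= gint h w.
Proof.
rewrite gPhiE /gint -RintegralZl//; last first.
  by apply: integrable_gphi => // x; rewrite ler01 lexx.
apply: le_Rintegral => //.
- under [X in _.-integrable _ X]eq_fun do rewrite mul1r.
  by apply: integrable_gphi => // x; exact: h01.
- exact: integrable_gphi.
- move=> x /=; rewrite in_itv/= mul1r => xw.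
  by rewrite ler_pM2r ?gphi_gt0// h_noninc.
Qed.

Lemma gint_le w : gint h w <= gPhi w.
Proof.
rewrite gPhiE /gint; apply: le_Rintegral => //.
- exact: integrable_gphi.
- by apply: integrable_gphi => // x; rewrite ler01 lexx.
- by move=> x _; rewrite ler_pM2r ?gphi_gt0//; case/andP: (h01 x).
Qed.

Lemma gtail_ge0 w : 0 <= gtail h w.
Proof.
apply: Rintegral_ge0 => x _; case/andP: (h01 x) => h0 _.
by rewrite mulr_ge0// ltW// gphi_gt0.
Qed.

Lemma gtail_le w : gtail h w <= h w * (1 - gPhi w).
Proof.
rewrite -gtail1 /gtail -RintegralZl//; last first.
  by apply: integrable_gphi => // x; rewrite ler01 lexx.
apply: le_Rintegral => //.
- exact: integrable_gphi.
- under [X in _.-integrable _ X]eq_fun do rewrite mul1r.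
  by apply: integrable_gphi => // x; exact: h01.
- move=> x /=; rewrite in_itv/= andbT mul1r => xw.
  by rewrite ler_pM2r ?gphi_gt0// h_noninc// ltW.
Qed.

Lemma gmeanE w : gmean h = gint h w + gtail h w.
Proof. exact: gint_tail. Qed.

(** Form of the solution in which the two half-lines play symmetric roles;
    all bounds below are read off from it. *)
Lemma steinM w :
  stein h w * gphi w = gint h w * (1 - gPhi w) - gtail h w * gPhi w.
Proof.
by rewrite /stein divfK ?gt_eqF ?gphi_gt0// (gmeanE w); ring.
Qed.

(** Monotonicity of [h]: its average over the left of [w] is at least [h w],
    which is at least its average over the right of [w]. *)
Lemma stein_ge0 w : 0 <= stein h w.
Proof.
rewrite -(pmulr_lge0 _ (gphi_gt0 w)) steinM.
have := gint_ge w; have := gtail_le w.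
by have := gPhi_ge0 w; have := gPhi_le1 w; nra.
Qed.

Lemma stein_le1 w : stein h w <= 1.
Proof.
rewrite -(ler_pM2r (gphi_gt0 w)) mul1r steinM.
apply: le_trans (gPhi_onem_le w).
have := gint_le w; have := gtail_ge0 w.
by have := gPhi_ge0 w; have := gPhi_le1 w; nra.
Qed.

(** For [0 <= w], Mills' bound gives [w * stein h w <= gint h w], so that the
    derivative is at most [h w - gtail h w].  For [w < 0] the same argument
    applies to [1 - h], with the two half-lines exchanged. *)
Lemma dstein_le1 w : `|dstein h w| <= 1.
Proof.
have p0 := gphi_gt0 w; have P0 := gPhi_ge0 w; have P1 := gPhi_le1 w.
have Q1 := gint_le w; have Q0 := gint_ge w.
have S0 := gtail_ge0 w; have S1 := gtail_le w.
have /andP[h0 h1] := h01 w; have f0 := stein_ge0 w; have E := steinM w.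
have m := mills w; have mN := millsN w.
rewrite ler_norml /dstein (gmeanE w).
set f := stein h w in f0 E *; set Q := gint h w in Q0 Q1 E *.
set S := gtail h w in S0 S1 E *; set p := gphi w in p0 E m mN *.
set F := gPhi w in P0 P1 Q0 Q1 S1 E m mN *.
have Q0' : 0 <= Q by apply: le_trans Q0; rewrite mulr_ge0.
have S1' : S <= 1 - F by apply: (le_trans S1); rewrite ler_piMl// subr_ge0.
have [w0|w0] := leP 0 w.
  have wf0 : 0 <= w * f by rewrite mulr_ge0.
  have wfQ : w * f <= Q.
    rewrite -(ler_pM2r p0) -mulrA E.
    have : Q * (w * (1 - F)) <= Q * p by rewrite ler_wpM2l.
    have : 0 <= w * (S * F) by rewrite !mulr_ge0.
    by nra.
  by apply/andP; split; lra.
have wf0 : w * f <= 0 by rewrite mulr_le0_ge0// ltW.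
have wfS : - (w * f) <= 1 - F - S.
  rewrite -(ler_pM2r p0) mulNr -mulrA E.
  have : (1 - F - S) * (- w * F) <= (1 - F - S) * p.
    by rewrite ler_wpM2l// subr_ge0.
  have : 0 <= - w * ((F - Q) * (1 - F)).
    by rewrite !mulr_ge0 ?subr_ge0 ?oppr_ge0 ?(ltW w0).
  by nra.
by apply/andP; split; lra.
Qed.

End stein.

(** * Taylor remainders *)

Section taylor.
Context {R : realType}.

(** Compare [f] with the parabola on the right-hand side: the derivative of the
    difference is nonpositive on the way to [u]. *)
Lemma taylor_le_pos (f df : R -> R) (C u : R) :
  (forall x : R, is_derive x 1 f (df x)) -> 0 <= u ->
  (forall v, 0 <= v <= u -> df v <= df 0 + C * v) ->
  f u - f 0 - u * df 0 <= C * u ^+ 2 / 2.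
Proof.
move=> Df u0 H.
have D (v : R) : is_derive v 1 (fun y => f y - (df 0 * y + C / 2 * (y * y)))
  (df v - (df 0 + C * v)).
  apply: is_derive1_eq (is_derive1B (Df v) (is_derive1D
    (is_derive1M (is_derive1_cst (df 0) v) (is_derive1_id v))
    (is_derive1M (is_derive1_cst (C / 2) v)
      (is_derive1M (is_derive1_id v) (is_derive1_id v))))) _.
  by rewrite /=; field.
have := @derive_le0_le _ _ _ 0 u D u0; rewrite !mulr0 addr0 subr0 => K.
suff : f u - (df 0 * u + C / 2 * (u * u)) <= f 0 by rewrite expr2; lra.
by apply: K => x /andP[x0 xu]; rewrite subr_le0; apply: H; rewrite !ltW.
Qed.

Lemma taylor_pos (f df : R -> R) (C u : R) :
  (forall x : R, is_derive x 1 f (df x)) -> 0 <= u ->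
  (forall v, 0 <= v <= u -> `|df v - df 0| <= C * v) ->
  `|f u - f 0 - u * df 0| <= C * u ^+ 2 / 2.
Proof.
move=> Df u0 H; rewrite ler_norml lerNl; apply/andP; split; last first.
  apply: taylor_le_pos => // v /H; rewrite ler_norml => /andP[]; lra.
have DN (x : R) : is_derive x 1 (fun y => 0 - f y) (0 - df x).
  exact: is_derive1B (is_derive1_cst 0 x) (Df x).
have : (0 - f u) - (0 - f 0) - u * (0 - df 0) <= C * u ^+ 2 / 2.
  apply: (@taylor_le_pos _ (fun x => 0 - df x)) => // v /H.
  by rewrite ler_norml => /andP[]; lra.
lra.
Qed.

Lemma taylor_bound (f df : R -> R) (C w u : R) :
  (forall x : R, is_derive x 1 f (df x)) ->
  (forall v, `|v| <= `|u| -> `|df (w + v) - df w| <= C * `|v|) ->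
  `|f (w + u) - f w - u * df w| <= C * u ^+ 2 / 2.
Proof.
move=> Df H.
have Dw (s x : R) : is_derive x 1 (fun y => w + s * y) s.
  apply: is_derive1_eq (is_derive1D (is_derive1_cst w x)
    (is_derive1M (is_derive1_cst s x) (is_derive1_id x))) _.
  by rewrite /=; ring.
(* The negative direction reduces to the positive one by reflection. *)
pose s : R := if 0 <= u then 1 else -1.
have uE : s * `|u| = u.
  by rewrite /s; case: (leP 0 u) => u0;
    [rewrite mul1r ger0_norm|rewrite mulN1r ltr0_norm// opprK].
have ns : `|s| = 1 by rewrite /s; case: ifP; rewrite ?normrN normr1.
have := @taylor_pos (fun y => f (w + s * y)) (fun y => df (w + s * y) * s)
  C `|u| _ (normr_ge0 u).
rewrite mulr0 addr0 uE real_normK ?num_real//.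
have -> : `|u| * (df w * s) = u * df w by rewrite -[in RHS]uE; ring.
move=> /(_ (fun x => @is_derive1_compose _ f
  (fun y => w + s * y) x _ _ (Df (w + s * x)) (Dw s x))).
apply=> v /andP[v0 vu].
rewrite -mulrBl normrM ns mulr1 -[in leRHS](ger0_norm v0).
have -> : `|v| = `|s * v| by rewrite normrM ns mul1r.
by apply: H; rewrite normrM ns mul1r ger0_norm.
Qed.

End taylor.

(** * Smoothed indicators of half-lines *)

Section ramp.
Context {R : realType}.
Implicit Types (t a b w x y : R).

(** Continuous version of the indicator of the half-line ending at [t]: it
    decreases linearly from 1 to 0 on the interval from [t] to [t + a]. *)
Definition ramp t a x : R := Num.max 0 (Num.min 1 ((t + a - x) / a)).

Lemma ramp01 t a x : 0 <= ramp t a x <= 1.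
Proof. by rewrite /ramp le_max lexx ge_max ler01 ge_min lexx. Qed.

Lemma ramp_noninc t a : 0 < a -> {homo ramp t a : x y /~ x <= y}.
Proof.
move=> a0 x y yx; rewrite /ramp.
have : (t + a - x) / a <= (t + a - y) / a.
  by rewrite ler_pM2r ?invr_gt0// lerB.
set p := _ / a; set q := _ / a => pq.
rewrite ge_max le_max lexx/= le_max; apply/orP; right.
by rewrite le_min !ge_min lexx/= pq orbT.
Qed.

Lemma ramp_eq1 t a x : 0 < a -> x <= t -> ramp t a x = 1.
Proof.
move=> a0 xt; apply/eqP; rewrite eq_le; have /andP[_ ->] := ramp01 t a x.
rewrite /ramp le_max le_min lexx/= ler_pdivlMr// mul1r.
by apply/orP; right; lra.
Qed.

Lemma ramp_eq0 t a x : 0 < a -> t + a <= x -> ramp t a x = 0.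
Proof.
move=> a0 xt; apply/eqP; rewrite eq_le; have /andP[-> _] := ramp01 t a x.
rewrite /ramp ge_max lexx/= ge_min andbT; apply/orP; right.
by rewrite ler_pdivrMr// mul0r subr_le0.
Qed.

Lemma ramp_lip t a x y : 0 < a -> `|ramp t a x - ramp t a y| <= `|x - y| / a.
Proof.
move=> a0; wlog xy : x y / x <= y.
  move=> H; have [/H//|/ltW/H] := leP x y.
  by rewrite distrC (distrC y).
rewrite (distrC x) !ger0_norm ?subr_ge0//; last exact: ramp_noninc.
rewrite /ramp; set p := _ / a; set q := _ / a.
have -> : (y - x) / a = p - q by rewrite /p /q; field; rewrite gt_eqF.
have : q <= p by rewrite /p /q ler_pM2r ?invr_gt0// lerB.
rewrite !maxEle !minEle; do !case: ifPn; lra.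
Qed.

(** The ramp is constant on each side of its slope, so that a displacement by
    at most [b] matters only from points within [b] of the slope. *)
Lemma ramp_incr t a b w u : 0 < a -> `|u| <= b ->
  `|ramp t a (w + u) - ramp t a w| <= `|u| / a * \1_`]t - b, t + a + b] w.
Proof.
move=> a0; rewrite ler_norml => /andP[bu ub]; rewrite indicE.
case: (boolP (w \in _)) => [_|].
  rewrite mulr1; apply: (le_trans (ramp_lip _ _ _ _ a0)).
  by rewrite addrAC subrr add0r.
rewrite notin_setE/= in_itv/= => /negP; rewrite negb_and -leNgt -ltNge mulr0.
case/orP => wt.
  by rewrite !ramp_eq1 ?subrr ?normr0//; lra.
by rewrite !ramp_eq0 ?subrr ?normr0//; lra.
Qed.

Lemma continuous_ramp t a : continuous (ramp t a).
Proof.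
move=> x; apply: (@continuous_max _ _ (cst 0)
    (fun y => Num.min 1 ((t + a - y) / a)) x); first exact: cvg_cst.
apply: (@continuous_min _ _ (cst 1) (fun y => (t + a - y) / a) x).
  exact: cvg_cst.
apply: cvgM; last exact: cvg_cst.
by apply: cvgB; [exact: cvg_cst|exact: cvg_id].
Qed.

End ramp.

Section stein_ramp.
Context {R : realType} (t a : R).
Hypothesis a0 : 0 < a.

Let f := stein (ramp t a).
Let df := dstein (ramp t a).

Let ch : continuous (ramp t a). Proof. exact: continuous_ramp. Qed.
Let hn : {homo ramp t a : x y /~ x <= y}. Proof. exact: ramp_noninc. Qed.
Let h01 x : 0 <= ramp t a x <= 1. Proof. exact: ramp01. Qed.

(** In [df (w + v) - df w] the product [w * f w] contributes
    [v * f (w + v) + w * (f (w + v) - f w)], bounded by [(1 + `|w|) * `|v|]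
    as [f] is bounded by 1 and 1-Lipschitz; the rest is the increment of the
    ramp. *)
Lemma stein_ramp_taylor (b w u : R) : `|u| <= b ->
  `|f (w + u) - f w - u * df w| <=
  b ^+ 2 / 2 * (1 + `|w| + a^-1 * \1_`]t - b, t + a + b] w).
Proof.
move=> ub; set C := 1 + _ + _.
have C0 : 0 <= C.
  by rewrite /C addr_ge0 ?addr_ge0// mulr_ge0// ?invr_ge0 ?ltW// indicE.
have flip x y : x <= y -> `|f y - f x| <= y - x.
  move=> xy.
  have := @derive_le0_le _ _ _ _ _ (fun z =>
    is_derive1B (is_derive_stein ch h01 z) (is_derive1_id z)) xy.
  have := @derive_le0_le _ _ _ _ _ (fun z =>
    is_derive1B (is_derive1B (is_derive1_cst 0 z) (is_derive1_id z))
      (is_derive_stein ch h01 z)) xy.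
  rewrite -/f ler_norml => H1 H2; apply/andP; split.
    suff : 0 - y - f y <= 0 - x - f x by lra.
    by apply: H1 => z _; have := dstein_le1 ch hn h01 z; rewrite ler_norml; lra.
  suff : f y - y <= f x - x by lra.
  by apply: H2 => z _; have := dstein_le1 ch hn h01 z; rewrite ler_norml; lra.
have flip' v : `|f (w + v) - f w| <= `|v|.
  have [v0|/ltW v0] := leP 0 v.
    apply: (le_trans (flip _ _ _)); first by rewrite lerDl.
    by rewrite addrAC subrr add0r ger0_norm.
  rewrite distrC; apply: (le_trans (flip _ _ _)); first by rewrite gerDl.
  by rewrite opprD addNKr ler0_norm.
apply: (@le_trans _ _ (C * u ^+ 2 / 2)); last first.
  have : u ^+ 2 <= b ^+ 2.
    by rewrite -real_normK ?num_real// lerXn2r// nnegrE// (le_trans _ ub).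
  by move=> /(ler_wpM2l C0); lra.
apply: taylor_bound => [x|v vu]; first exact: is_derive_stein.
have -> : df (w + v) - df w =
  v * f (w + v) + w * (f (w + v) - f w) + (ramp t a (w + v) - ramp t a w).
  by rewrite /df /dstein -/f; ring.
rewrite /C !mulrDl mul1r; apply: (le_trans (ler_normD _ _)); apply: lerD; last first.
  apply: (le_trans (ramp_incr _ _ _ _ _ a0 (le_trans vu ub))).
  by rewrite [leRHS]mulrAC [a^-1 * _]mulrC.
apply: (le_trans (ler_normD _ _)); rewrite (normrM v) (normrM w); apply: lerD.
  rewrite ler_piMr// /f (ger0_norm (stein_ge0 ch hn h01 _)).
  exact: (stein_le1 ch h01).
by rewrite ler_wpM2l.
Qed.

Lemma gmean_ramp : gPhi t <= gmean (ramp t a) <= gPhi (t + a).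
Proof.
apply/andP; split.
  rewrite (gmeanE ch h01 t); have := gint_ge ch hn h01 t.
  by rewrite ramp_eq1// mul1r; have := gtail_ge0 h01 t; lra.
rewrite (gmeanE ch h01 (t + a)); have := gtail_le ch hn h01 (t + a).
by rewrite ramp_eq0// mul0r; have := gint_le ch h01 (t + a); lra.
Qed.

End stein_ramp.

(** * Means of real functions *)

Local Notation mean P f := (Rintegral P setT f).
Local Notation L1 P f := (P.-integrable setT (EFin \o f)).

Section expectations.
Context {d : measure_display} {T : measurableType d} {R : realType}.
Variable P : probability T R.
Implicit Types (f g : T -> R).

Lemma integrable_of_bounded f (M : R) : measurable_fun setT f ->
  (forall w, `|f w| <= M) -> L1 P f.
Proof.
move=> mf fM; apply: measurable_bounded_integrable => //.
  by apply: (le_lt_trans (probability_le1 P measurableT)); rewrite ltry.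
exists M; split; first exact: num_real.
by move=> x Mx w _; exact: le_trans (fM w) (ltW Mx).
Qed.

Lemma integrable_cst_fun (r : R) : L1 P (fun=> r).
Proof. exact: finite_measure_integrable_cst. Qed.

Lemma mean_cst (r : R) : mean P (fun=> r) = r.
Proof. by rewrite Rintegral_cst// [X in fine X](probability_setT P) mulr1. Qed.

Lemma integrable_add f g : L1 P f -> L1 P g -> L1 P (fun w => f w + g w).
Proof.
move=> If Ig; have := integrableD measurableT If Ig.
by apply: eq_integrable.
Qed.

Lemma integrable_scale (r : R) f : L1 P f -> L1 P (fun w => r * f w).
Proof. by move=> If; have := integrableZl measurableT r If; exact: eq_integrable. Qed.

Lemma integrable_sub f g : L1 P f -> L1 P g -> L1 P (fun w => f w - g w).
Proof.
move=> If Ig; have := integrableB measurableT If Ig.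
by apply: eq_integrable.
Qed.

Lemma integrable_dominated f g : measurable_fun setT f ->
  (forall w, `|f w| <= g w) -> L1 P g -> L1 P f.
Proof.
move=> mf fg; apply: le_integrable => //; first exact/measurable_EFinP.
by move=> w _; rewrite lee_fin (le_trans (fg w))// ler_norm.
Qed.

Lemma integrable_abs f : L1 P f -> L1 P (fun w => `|f w|).
Proof.
move=> /[dup] /measurable_int /measurable_EFinP mf.
apply: le_integrable => //; first by apply/measurable_EFinP; exact: measurableT_comp.
by move=> w _; rewrite lee_fin /= normr_id.
Qed.

Lemma norm_mean_le f g : L1 P f -> L1 P g -> (forall w, `|f w| <= g w) ->
  `|mean P f| <= mean P g.
Proof.
move=> If Ig fg; apply: (le_trans (le_normr_Rintegral _ If)) => //.
by apply: le_Rintegral => //; exact: integrable_abs.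
Qed.

End expectations.

Section mean_lemmas.
Context {d : measure_display} {T : measurableType d} {R : realType}.
Variable P : probability T R.
Implicit Types (f g V F : T -> R).

Lemma mean_dominated_cvg (f_ : nat -> T -> R) f g :
  (forall n, measurable_fun setT (f_ n)) -> measurable_fun setT f ->
  (forall w, f_ n w @[n --> \oo] --> f w) ->
  L1 P g -> (forall n w, `|f_ n w| <= g w) ->
  mean P (f_ n) @[n --> \oo] --> mean P f.
Proof.
move=> mf_ mf cf Ig fg.
have [] := @dominated_convergence _ _ _ P setT measurableT
    (fun n w => (f_ n w)%:E) (EFin \o f) (EFin \o g).
- by move=> n; exact/measurable_EFinP.
- exact/measurable_EFinP.
- apply: aeW => w _; apply: cvg_EFin; last exact: cf.
  exact: nearW.
- exact: Ig.
- by apply: aeW => w n _; rewrite lee_fin.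
move=> If _; have fin := integrable_fin_num measurableT If.
by rewrite -[X in _ --> X](fineK fin) => /fine_cvg.
Qed.

Lemma mean_ae_eq f g : measurable_fun setT f -> measurable_fun setT g ->
  (\forall w \ae P, f w = g w) -> mean P f = mean P g.
Proof.
move=> mf mg fg; rewrite /Rintegral; congr fine; apply: ae_eq_integral => //.
- exact/measurable_EFinP.
- exact/measurable_EFinP.
- by apply: filterS fg => w fgw _ /=; rewrite fgw.
Qed.

Lemma mean_le f g : L1 P f -> L1 P g -> (forall w, f w <= g w) -> mean P f <= mean P g.
Proof. by move=> If Ig fg; apply: le_Rintegral. Qed.

Lemma mean_indic f (A : set T) : measurable A ->
  mean P (fun w => f w * \1_A w) = \int[P]_(w in A) f w.
Proof.
move=> mA; rewrite [RHS]Rintegral_mkcond; apply: eq_Rintegral => w _.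
by rewrite patchE indicE; case: ifP => _; rewrite ?mulr1 ?mulr0.
Qed.

Lemma integrable_mul_bounded f g (M : R) : L1 P f -> measurable_fun setT g ->
  (forall w, `|g w| <= M) -> L1 P (fun w => f w * g w).
Proof.
move=> If mg gM; have /measurable_EFinP mf := measurable_int _ If.
apply: (@integrable_dominated _ _ _ _ _ (fun w => M * `|f w|)).
- exact: measurable_funM.
- by move=> w; rewrite normrM mulrC ler_pM.
- by apply: integrable_scale; exact: integrable_abs.
Qed.

Lemma sum_levels_near (n : nat) (x : R) : 0 <= x <= n%:R ->
  `|x - \sum_(k < n) (k.+1%:R <= x)%R%:R| <= 1.
Proof.
move=> /andP[x0 xn].
have -> : \sum_(k < n) (k.+1%:R <= x)%R%:R = (Num.truncn x)%:R :> R.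
  have tn : (Num.truncn x <= n)%N.
    by rewrite -(ler_nat R) (le_trans _ xn)// truncn_le.
  under eq_bigr do rewrite -truncn_gt_nat.
  rewrite -natr_sum -big_mkcond/=; congr (_%:R).
  by rewrite (big_ord_narrow tn) sum1_card card_ord.
have /andP[m1 m2] := truncn_itv x0; rewrite ler_norml.
by move: m2; rewrite -natr1; lra.
Qed.

(** Orthogonality to the level sets of [F] passes to [F], which is a uniform
    limit of linear combinations of their indicators.  With [V] the difference
    between a variable and its conditional expectation, this extends the
    defining property of the latter from events to bounded functions. *)
Lemma mean_mul_eq0 V F : L1 P V -> measurable_fun setT F ->
  (forall w, 0 <= F w <= 1) ->
  (forall s, mean P (fun w => V w * (s <= F w)%R%:R) = 0) ->
  mean P (fun w => V w * F w) = 0.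
Proof.
move=> IV mF F01 H.
have mI s : measurable_fun setT (fun w => (s <= F w)%R%:R : R).
  have -> : (fun w => (s <= F w)%R%:R : R) = \1_[set w | s <= F w].
    apply/funext => w; rewrite indicE; congr (nat_of_bool _)%:R.
    by apply/idP/idP; rewrite inE.
  apply: measurable_indic.
  rewrite -[X in measurable X]setTI; exact: measurable_fun_le.
have IVI s : L1 P (fun w => V w * (s <= F w)%R%:R).
  apply: (@integrable_mul_bounded _ _ 1) => // w.
  by case: (s <= F w); rewrite ?normr1 ?normr0.
have Isum n (s : nat -> R) :
    L1 P (fun w => \sum_(k < n) V w * (s k <= F w)%R%:R) /\
    mean P (fun w => \sum_(k < n) V w * (s k <= F w)%R%:R) = 0.
  elim: n => [|n [I E]].
    under eq_fun do rewrite big_ord0.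
    by split; [exact: integrable_cst_fun|rewrite mean_cst].
  under eq_fun do rewrite big_ord_recr/=.
  by split; [exact: integrable_add|rewrite RintegralD// E H addr0].
(* Approximate F from its first n + 1 level sets, at distance 1 / (n + 1). *)
have bnd (n : nat) :
    `|mean P (fun w => V w * F w)| <= n.+1%:R^-1 * mean P (fun w => `|V w|).
  pose S w := \sum_(k < n.+1) V w * (k.+1%:R / n.+1%:R <= F w)%R%:R.
  have [IS ES] := Isum n.+1 (fun k => k.+1%:R / n.+1%:R).
  have IVF : L1 P (fun w => V w * F w).
    apply: (@integrable_mul_bounded _ _ 1) => // w.
    by have /andP[? ?] := F01 w; rewrite ger0_norm.
  have SE w : S w = V w * \sum_(k < n.+1) (k.+1%:R <= n.+1%:R * F w)%R%:R.
    rewrite /S mulr_sumr; apply: eq_bigr => k _.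
    by rewrite ler_pdivrMr// [_ * F w]mulrC.
  have IS' := integrable_scale _ n.+1%:R^-1 _ IS.
  have -> : mean P (fun w => V w * F w) =
      mean P (fun w => V w * F w - n.+1%:R^-1 * S w).
    by rewrite RintegralB// RintegralZl// ES mulr0 subr0.
  rewrite -RintegralZl//; last exact: integrable_abs.
  apply: norm_mean_le.
  - exact: integrable_sub.
  - by apply: integrable_scale; exact: integrable_abs.
  move=> w; have n0 : 0 < n.+1%:R :> R by rewrite ltr0n.
  have -> : V w * F w - n.+1%:R^-1 * S w = n.+1%:R^-1 * (V w *
      (n.+1%:R * F w - \sum_(k < n.+1) (k.+1%:R <= n.+1%:R * F w)%R%:R)).
    by rewrite SE; field; rewrite gt_eqF.
  have ni0 : 0 < n.+1%:R^-1 :> R by rewrite invr_gt0.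
  rewrite normrM (ger0_norm (ltW ni0)) (ler_pM2l ni0).
  rewrite normrM ler_piMr// sum_levels_near//.
  by have /andP[? ?] := F01 w; rewrite mulr_ge0 ?(ltW n0)//= ler_piMr// ltW.
apply/eqP/contraT; rewrite -normr_gt0 => x0.
set x := `| _ | in x0 bnd; set C := mean P _ in bnd.
have := bnd (Num.truncn (C / x)); rewrite ler_pdivlMl// => /le_lt_trans.
have := truncnS_gt (C / x); rewrite ltr_pdivrMr// => h /(_ _ h).
by rewrite ltxx.
Qed.

End mean_lemmas.

Section second_moment.
Context {d : measure_display} {T : measurableType d} {R : realType}.
Variable P : probability T R.
Implicit Types (f g V : T -> R).

(** Cauchy-Schwarz against the constant 1, from the inequality
    [2 * r * `|v| <= r ^+ 2 + v ^+ 2] for [r] close to the right-hand side. *)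
Lemma mean_norm_le_sqrt V : L1 P V -> L1 P (fun w => V w ^+ 2) ->
  mean P (fun w => `|V w|) <= Num.sqrt (mean P (fun w => V w ^+ 2)).
Proof.
move=> IV IV2; set S := mean P (fun w => V w ^+ 2).
have S0 : 0 <= S by apply: Rintegral_ge0 => w _; exact: sqr_ge0.
apply/ler_addgt0Pr => e e0; set r := _ + e.
have r0 : 0 < r by rewrite ltr_wpDl// sqrtr_ge0.
have Sr : S <= r ^+ 2.
  rewrite -(sqr_sqrtr S0) lerXn2r ?nnegrE ?sqrtr_ge0 ?(ltW r0)//.
  by rewrite lerDl ltW.
apply: (@le_trans _ _ (mean P (fun w => 2^-1 * r + (2 * r)^-1 * V w ^+ 2))).
  apply: mean_le.
  - exact: integrable_abs.
  - by apply: integrable_add; [exact: integrable_cst_fun|exact: integrable_scale].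
  move=> w; rewrite -(@real_normK _ (V w)) ?num_real//.
  rewrite -(ler_pM2l r0) -subr_ge0.
  have -> : r * (2^-1 * r + (2 * r)^-1 * `|V w| ^+ 2) - r * `|V w| =
    2^-1 * (r - `|V w|) ^+ 2 by field; rewrite gt_eqF.
  by rewrite mulr_ge0// sqr_ge0.
rewrite RintegralD//; [|exact: integrable_cst_fun|exact: integrable_scale].
rewrite mean_cst RintegralZl// -/S.
have : (2 * r)^-1 * S <= (2 * r)^-1 * r ^+ 2.
  by rewrite ler_wpM2l// invr_ge0 mulr_ge0// ltW.
have -> : (2 * r)^-1 * r ^+ 2 = 2^-1 * r by field; rewrite gt_eqF.
by lra.
Qed.

Lemma ae_le0_of_mean V : L1 P V ->
  mean P (fun w => V w * \1_[set w | 0 < V w] w) <= 0 ->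
  \forall w \ae P, V w <= 0.
Proof.
move=> IV H; have /measurable_EFinP mV := measurable_int _ IV.
have mA : measurable [set w | 0 < V w].
  rewrite (_ : [set w | _] = setT `&` V @^-1` `]0, +oo[); first exact: mV.
  by rewrite setTI; apply/seteqP; split => w /=; rewrite in_itv/= andbT.
set g := fun w => V w * _ in H.
have mg : measurable_fun setT g by apply: measurable_funM => //; exact: measurable_indic.
have g0 w : 0 <= g w.
  rewrite /g indicE; case: (boolP (w \in _)); rewrite ?mulr0// inE/= mulr1; exact: ltW.
have Ig : L1 P g.
  apply: (@integrable_mul_bounded _ _ _ _ _ _ 1) => //.
  by move=> w; rewrite indicE; case: (w \in _); rewrite ?normr1 ?normr0.
have Eg : (\int[P]_w (g w)%:E = 0)%E.
  rewrite -[LHS](fineK (integrable_fin_num measurableT Ig)); congr EFin.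
  by apply/eqP; rewrite eq_le H/= Rintegral_ge0.
have := (ae_eq_integral_abs P measurableT ((measurable_EFinP _ _).2 mg)).1.
under eq_integral do rewrite /= ger0_norm//.
move=> /(_ Eg); apply: filterS => w /(_ I)/= [] gw0; rewrite leNgt; apply/negP => Vw.
by move: gw0 (Vw); rewrite /g indicE mem_set// mulr1 => ->; rewrite ltxx.
Qed.

Lemma integrable_sqr_ae_bounded f (M : R) : measurable_fun setT f ->
  (\forall w \ae P, `|f w| <= M) -> L1 P (fun w => f w ^+ 2).
Proof.
move=> mf fM; have mf2 : measurable_fun setT (fun w => f w ^+ 2).
  exact: measurable_funX.
apply/integrableP; split; first exact/measurable_EFinP.
apply: (@le_lt_trans _ _ (\int[P]_w (M ^+ 2)%:E)%E); last first.
  by rewrite integral_cst//= [X in (_ * X)%E](probability_setT P) mule1 ltry.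
apply: ae_ge0_le_integral => //.
- by apply: measurableT_comp => //; exact/measurable_EFinP.
- by move=> w _; rewrite lee_fin sqr_ge0.
apply: filterS fM => w fwM _; rewrite /= lee_fin ger0_norm ?sqr_ge0//.
rewrite -real_normK ?num_real// lerXn2r// nnegrE//.
exact: le_trans fwM.
Qed.

Lemma std_devE f : std_dev P f = Num.sqrt (mean P (fun w => (f w - mean P f) ^+ 2)).
Proof.
rewrite /std_dev /variance covariance.unlock; congr (Num.sqrt (fine _)).
rewrite unlock; apply: eq_integral => w _.
by rewrite /= expr2 /Rintegral.
Qed.

End second_moment.

(** * The smoothing inequality *)

(** Here [W] is the standardised variable, [U] the displacement of its coupled
    copy, [c] a conditional mean of [U] given [W], and [D] any bound on the
    Kolmogorov distance from [W] to the standard normal law. *)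
Section core.
Context {d : measure_display} {T : measurableType d} {R : realType}.
Variables (P : probability T R) (W U c : T -> R) (lam b D Delta : R).

Hypothesis mW : measurable_fun setT W.
Hypothesis mU : measurable_fun setT U.
Hypothesis L1c : L1 P c.
Hypothesis lam0 : 0 <= lam.
Hypothesis b0 : 0 <= b.
Hypothesis Ub : forall w, `|U w| <= b.
Hypothesis L2W : L1 P (fun w => W w ^+ 2).
Hypothesis EW2 : mean P (fun w => W w ^+ 2) = 1.
Hypothesis stein_identity : forall f : R -> R, continuous f ->
  (forall x, `|f x| <= 1) ->
  mean P (fun w => W w * f (W w)) =
  lam * (mean P (fun w => f (W w + U w)) - mean P (fun w => f (W w))).
Hypothesis cond_identity : forall f : R -> R, continuous f ->
  (forall x, `|f x| <= 1) ->
  mean P (fun w => U w * f (W w)) = mean P (fun w => c w * f (W w)).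
Hypothesis lamU : lam * mean P U = 1.
Hypothesis c_dev : mean P (fun w => `|c w - mean P c|) <= Delta.

Let F t := fine (P [set w | W w <= t]).
Hypothesis F_dist : forall t, `|F t - gPhi t| <= D.

Let mle t : measurable [set w | W w <= t].
Proof. by rewrite -[X in measurable X]setTI; exact: measurable_fun_le. Qed.

Let L1W : L1 P (fun w => `|W w|).
Proof.
apply: (@integrable_dominated _ _ _ P _ (fun w => 1 + W w ^+ 2)).
- exact: measurableT_comp.
- by move=> w; rewrite normr_id ler_norml; apply/andP; split; nra.
- by apply: integrable_add => //; exact: integrable_cst_fun.
Qed.

Let mean_absW : mean P (fun w => `|W w|) <= 1.
Proof.
apply: (@le_trans _ _ (mean P (fun w => 2^-1 * (1 + W w ^+ 2)))).
  apply: le_Rintegral => //.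
    by apply/integrable_scale/integrable_add => //; exact: integrable_cst_fun.
  move=> w _; rewrite -(@real_normK _ (W w)) ?num_real//.
  by have := sqr_ge0 (`|W w| - 1); lra.
have I1 := integrable_cst_fun P 1.
by rewrite RintegralZl// ?RintegralD ?mean_cst ?EW2//; [lra|exact: integrable_add].
Qed.

Let FE s : F s = mean P (\1_[set w | W w <= s]).
Proof. by rewrite /Rintegral integral_indic// setIT. Qed.

Let I_cdf s : L1 P (\1_[set w | W w <= s]).
Proof.
apply: (@integrable_of_bounded _ _ _ _ _ 1); first exact: measurable_indic.
by move=> w; rewrite indicE; case: (_ \in _); rewrite ?normr1 ?normr0.
Qed.

Let F_slab x y : x <= y ->
  mean P (\1_`]x, y] \o W) <= 2 * D + (y - x) / 2.
Proof.
move=> xy.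
have -> : mean P (\1_`]x, y] \o W) = F y - F x.
  rewrite !FE -RintegralB; [|by []|exact: I_cdf|exact: I_cdf].
  apply: eq_Rintegral => w _; rewrite /= !indicE.
  have e s : (w \in [set w | W w <= s]) = (W w <= s).
    by apply/idP/idP; rewrite inE.
  rewrite !e mem_setE in_itv/= ltNge.
  have [Wx|xW] := leP (W w) x; first by rewrite (le_trans Wx xy) subrr.
  by rewrite subr0.
have := F_dist x; have := F_dist y; have := gPhi_lip _ _ xy.
rewrite !ler_norml; lra.
Qed.

(** Stein's identity at the solution for the ramp; the probability that [W]
    falls near the slope is estimated by means of the distance [D] itself. *)
Lemma smoothed_bound (t a : R) : 0 < a ->
  `|mean P (ramp t a \o W) - gmean (ramp t a)| <=
  lam * (Delta + b ^+ 2 / 2 * (2 + (2 * D + (a + 2 * b) / 2) / a)).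
Proof.
move=> a0; set h := ramp t a.
have ch : continuous h by exact: continuous_ramp.
have hn : {homo h : x y /~ x <= y} by exact: ramp_noninc.
have h01 x : 0 <= h x <= 1 by exact: ramp01.
pose f := stein h; pose df := dstein h.
have cf : continuous f by exact: continuous_stein.
have cdf : continuous df by exact: continuous_dstein.
have f1 x : `|f x| <= 1.
  by rewrite ger0_norm ?(stein_le1 ch h01)// (stein_ge0 ch hn h01).
have df1 x : `|df x| <= 1 by exact: dstein_le1.
have hE x : h x = (df x - x * f x) + gmean h.
  by rewrite /df /dstein -/f; ring.
have taylor w u : `|u| <= b -> `|f (w + u) - f w - u * df w| <=
    b ^+ 2 / 2 * (1 + `|w| + a^-1 * \1_`]t - b, t + a + b] w).
  exact: stein_ramp_taylor.
(* Kept transparent, [df] would be unfolded into a sum when integrals of sums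
   are split below. *)
clearbody f df.
have mf : measurable_fun setT f by exact: continuous_measurable_fun.
have mdf : measurable_fun setT df by exact: continuous_measurable_fun.
have IdfW : L1 P (fun w => df (W w)).
  by apply: (@integrable_of_bounded _ _ _ _ _ 1) => //; exact: measurableT_comp.
have IfW : L1 P (fun w => f (W w)).
  by apply: (@integrable_of_bounded _ _ _ _ _ 1) => //; exact: measurableT_comp.
have IfWU : L1 P (fun w => f (W w + U w)).
  apply: (@integrable_of_bounded _ _ _ _ _ 1) => //.
  by apply: measurableT_comp => //; exact: measurable_funD.
have IUdf : L1 P (fun w => U w * df (W w)).
  apply: (@integrable_of_bounded _ _ _ _ _ b).
    by apply: measurable_funM => //; exact: measurableT_comp.
  by move=> w; rewrite normrM -[leRHS]mulr1 ler_pM.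
have mc : measurable_fun setT c by exact/measurable_EFinP/(measurable_int _ L1c).
have Icdf : L1 P (fun w => c w * df (W w)).
  apply: (@integrable_dominated _ _ _ _ _ (fun w => `|c w|)).
  - by apply: measurable_funM => //; exact: measurableT_comp.
  - by move=> w; rewrite normrM -[leRHS]mulr1 ler_pM.
  - exact: integrable_abs.
have IWf : L1 P (fun w => W w * f (W w)).
  apply: (@integrable_dominated _ _ _ _ _ (fun w => `|W w|)) => //.
  - by apply: measurable_funM => //; exact: measurableT_comp.
  - by move=> w; rewrite normrM -[leRHS]mulr1 ler_pM.
pose rem w := f (W w + U w) - f (W w) - U w * df (W w).
have Irem : L1 P rem by do 2!apply: integrable_sub => //.
have EcU : mean P c = mean P U.
  have m1 (g : T -> R) : mean P (fun w => g w * 1) = mean P g.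
    by apply: eq_Rintegral => w _; rewrite mulr1.
  rewrite -[LHS]m1 -[RHS]m1; apply/esym/(cond_identity (cst 1)) => x.
    exact: cvg_cst.
  by rewrite normr1.
(* The term E[df (W)] is lam * E[U] * E[df (W)], which centres c. *)
have E1 : mean P (h \o W) - gmean h =
    - lam * (mean P (fun w => (c w - mean P c) * df (W w)) + mean P rem).
  have -> : mean P (h \o W) = mean P (fun w => (df (W w) - W w * f (W w)) + gmean h).
    by apply: eq_Rintegral => w _; rewrite /= hE.
  rewrite RintegralD//; [|exact: integrable_sub|exact: integrable_cst_fun].
  rewrite RintegralB// mean_cst stein_identity// /rem.
  rewrite RintegralB//; last exact: integrable_sub.
  rewrite RintegralB// cond_identity//.
  have -> : mean P (fun w => (c w - mean P c) * df (W w)) =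
      mean P (fun w => c w * df (W w) - mean P c * df (W w)).
    by apply: eq_Rintegral => w _; rewrite mulrBl.
  rewrite RintegralB//; last exact: integrable_scale.
  rewrite RintegralZl// EcU.
  by rewrite -[X in X - lam * _]mul1r -lamU; ring.
rewrite E1 normrM normrN (ger0_norm lam0) ler_wpM2l//.
apply: (le_trans (ler_normD _ _)); apply: lerD.
  have Ic0 : L1 P (fun w => c w - mean P c).
    by apply: integrable_sub => //; exact: integrable_cst_fun.
  apply: le_trans c_dev; apply: norm_mean_le.
  - apply: (@integrable_dominated _ _ _ _ _ (fun w => `|c w - mean P c|)).
    + apply: measurable_funM; last exact: measurableT_comp.
      exact: measurable_funB.
    + by move=> w; rewrite normrM -[leRHS]mulr1 ler_pM.
    + exact: integrable_abs.
  - exact: integrable_abs.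
  - by move=> w; rewrite normrM -[leRHS]mulr1 ler_pM.
pose g w := b ^+ 2 / 2 * (1 + `|W w| + a^-1 * \1_`]t - b, t + a + b] (W w)).
have I1 : L1 P (fun w => 1 + `|W w|).
  by apply: integrable_add => //; exact: integrable_cst_fun.
have I2 : L1 P (\1_`]t - b, t + a + b] \o W).
  apply: (@integrable_of_bounded _ _ _ _ _ 1).
    by apply: measurableT_comp => //; exact: measurable_indic.
  by move=> w; rewrite /= indicE; case: (_ \in _); rewrite ?normr1 ?normr0.
have Ig : L1 P g.
  by apply/integrable_scale/integrable_add => //; exact: integrable_scale.
apply: (@le_trans _ _ (mean P g)).
  by apply: norm_mean_le => // w; exact: taylor.
rewrite /g RintegralZl//; last by apply: integrable_add => //; exact: integrable_scale.
rewrite ler_wpM2l ?divr_ge0 ?sqr_ge0// RintegralD//; last exact: integrable_scale.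
rewrite RintegralD//; last exact: integrable_cst_fun.
rewrite mean_cst RintegralZl// [X in _ <= _ + X]mulrC.
have tt : t - b <= t + a + b.
  apply: (@le_trans _ _ t); first by rewrite gerBl.
  by rewrite -addrA lerDl addr_ge0// ltW.
rewrite lerD ?ler_wpM2l ?invr_ge0 ?(ltW a0)//.
  by have := mean_absW; lra.
apply: le_trans (F_slab _ _ tt) _; lra.
Qed.

(** A half-line is squeezed between two ramps of width [a]; the Gaussian
    measure of the slope is at most [a / 2]. *)
Lemma core_bound (t a : R) : 0 < a ->
  `|F t - gPhi t| <=
  a / 2 + lam * (Delta + b ^+ 2 / 2 * (2 + (2 * D + (a + 2 * b) / 2) / a)).
Proof.
move=> a0.
have Ih s : L1 P (ramp s a \o W).
  apply: (@integrable_of_bounded _ _ _ _ _ 1).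
    apply: measurableT_comp => //; apply: continuous_measurable_fun.
    exact: continuous_ramp.
  by move=> w; have /andP[r0 r1] := ramp01 s a (W w); rewrite /= ger0_norm.
have up : F t <= mean P (ramp t a \o W).
  rewrite FE; apply: le_Rintegral; [by []|exact: I_cdf|exact: Ih|move=> w _].
  rewrite ?indicE; case: (boolP (w \in _)) => [|_].
    by rewrite inE/= => Wt; rewrite ramp_eq1.
  by rewrite /=; case/andP: (ramp01 t a (W w)).
have lo : mean P (ramp (t - a) a \o W) <= F t.
  rewrite FE; apply: le_Rintegral; [by []|exact: Ih|exact: I_cdf|move=> w _].
  rewrite ?indicE; case: (boolP (w \in _)) => [_|].
    by rewrite /=; case/andP: (ramp01 (t - a) a (W w)).
  by rewrite notin_setE/= => /negP; rewrite -ltNge => tW; rewrite ramp_eq0// subrK ltW.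
have := smoothed_bound t a a0; have := smoothed_bound (t - a) a a0.
set K := lam * _; rewrite !ler_norml.
have := gmean_ramp t a a0; have := gmean_ramp (t - a) a a0; rewrite subrK.
have h1 : t - a <= t by lra.
have h2 : t <= t + a by lra.
by have := gPhi_lip _ _ h1; have := gPhi_lip _ _ h2; lra.
Qed.

End core.

(** * Truncation *)

Section clip.
Context {R : realType}.
Implicit Types (M x : R).

Definition clip M x : R := Num.max (- M) (Num.min M x).

Lemma norm_clip_le M x : 0 <= M -> `|clip M x| <= M.
Proof.
move=> M0; rewrite ler_norml /clip le_max lexx ge_max ge_min lexx andbT/=.
by lra.
Qed.

Lemma clip_id M x : `|x| <= M -> clip M x = x.
Proof.
by rewrite ler_norml /clip => /andP[Mx xM]; rewrite (min_idPr xM) (max_idPr Mx).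
Qed.

Lemma norm_clip_le_norm M x : 0 <= M -> `|clip M x| <= `|x|.
Proof.
move=> M0; have [xM|/ltW Mx] := leP `|x| M; first by rewrite clip_id.
by apply: le_trans Mx; exact: norm_clip_le.
Qed.

Lemma continuous_clip M : continuous (clip M).
Proof.
move=> x; apply: (@continuous_max _ _ (cst (- M)) (fun y => Num.min M y) x).
  exact: cvg_cst.
apply: (@continuous_min _ _ (cst M) id x); first exact: cvg_cst.
exact: cvg_id.
Qed.

Lemma measurable_clip M : measurable_fun setT (clip M).
Proof. by apply: continuous_measurable_fun; exact: continuous_clip. Qed.

Lemma cvg_clip x : clip n%:R x @[n --> \oo] --> x.
Proof.
apply: cvg_near_cst; near=> n; apply/clip_id.
near: n; exact: nbhs_infty_ger.
Unshelve. all: by end_near. Qed.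

End clip.

(** * Conditional expectation *)

Section conditional_expectation.
Context {d : measure_display} {T : measurableType d} {R : realType}.
Variables (P : probability T R) (Y X c : T -> R).

Hypothesis mY : measurable_fun setT Y.
Hypothesis L1X : L1 P X.
Hypothesis L1c : L1 P c.
Hypothesis cX : forall A : set R, measurable A ->
  \int[P]_(w in Y @^-1` A) c w = \int[P]_(w in Y @^-1` A) X w.

Let mpre (A : set R) : measurable A -> measurable (Y @^-1` A).
Proof. by move=> mA; rewrite -[X in measurable X]setTI; exact: mY. Qed.

Lemma cond_mean : mean P c = mean P X.
Proof. by have := cX _ (measurableT : measurable [set: R]); rewrite preimage_setT. Qed.

Lemma cond_mean_mul (F : R -> R) : measurable_fun setT F ->
  (forall y, `|F y| <= 1) ->
  mean P (fun w => X w * F (Y w)) = mean P (fun w => c w * F (Y w)).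
Proof.
move=> mF F1.
(* F is rescaled to take its values in [0, 1]; constants are harmless since
   X - c has mean 0. *)
pose V w := X w - c w; pose F' w := (F (Y w) + 1) / 2.
have IV : L1 P V by exact: integrable_sub.
have mF' : measurable_fun setT F'.
  by apply: measurable_funM => //; apply: measurable_funD => //; exact: measurableT_comp.
have IVF : L1 P (fun w => V w * F (Y w)).
  by apply: (@integrable_mul_bounded _ _ _ _ _ _ 1) => //; exact: measurableT_comp.
have IXF : L1 P (fun w => X w * F (Y w)).
  by apply: (@integrable_mul_bounded _ _ _ _ _ _ 1) => //; exact: measurableT_comp.
have IcF : L1 P (fun w => c w * F (Y w)).
  by apply: (@integrable_mul_bounded _ _ _ _ _ _ 1) => //; exact: measurableT_comp.
have := mean_mul_eq0 P V F' IV mF'.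
have -> : mean P (fun w => V w * F' w) =
    mean P (fun w => 2^-1 * (V w * F (Y w)) + 2^-1 * V w).
  by apply: eq_Rintegral => w _; rewrite /F'; field.
rewrite RintegralD//; [|exact: integrable_scale|exact: integrable_scale].
rewrite !RintegralZl//.
have -> : mean P V = 0 by rewrite RintegralB// cond_mean subrr.
have -> : mean P (fun w => V w * F (Y w)) =
    mean P (fun w => X w * F (Y w)) - mean P (fun w => c w * F (Y w)).
  by rewrite -RintegralB//; apply: eq_Rintegral => w _; rewrite mulrBl.
move=> H; suff : 2^-1 * (mean P (fun w => X w * F (Y w)) -
    mean P (fun w => c w * F (Y w))) + 2^-1 * 0 = 0 by lra.
apply: H => [w|s].
  by have := F1 (Y w); rewrite ler_norml /F'; lra.
pose A := [set y | s <= (F y + 1) / 2].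
have mA : measurable A.
  rewrite (_ : A = setT `&` (fun y => (F y + 1) / 2) @^-1` `[s, +oo[).
    have : measurable_fun setT (fun y => (F y + 1) / 2).
      by apply: measurable_funM => //; exact: measurable_funD.
    by apply.
  by rewrite setTI; apply/seteqP; split => y /=; rewrite in_itv/= andbT.
have -> : mean P (fun w => V w * (s <= F' w)%R%:R) =
    mean P (fun w => V w * \1_(Y @^-1` A) w).
  apply: eq_Rintegral => w _; rewrite indicE; congr (_ * (nat_of_bool _)%:R).
  by apply/idP/idP; rewrite inE.
rewrite mean_indic ?RintegralB ?cX ?subrr//; try exact: mpre.
all: by apply: (integrableS measurableT) => //; exact: mpre.
Qed.

(** Integrate [c - M] over the event where it is positive: there [c] may be
    replaced with [X], and [X - M] is nonpositive. *)
Lemma cond_ae_le (M : R) : (forall w, X w <= M) ->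
  (exists2 A : set R, measurable A & [set w | M < c w] = Y @^-1` A) ->
  \forall w \ae P, c w <= M.
Proof.
move=> XM [A mA AE].
have IcM : L1 P (fun w => c w - M).
  by apply: integrable_sub => //; exact: integrable_cst_fun.
have IXM : L1 P (fun w => X w - M).
  by apply: integrable_sub => //; exact: integrable_cst_fun.
have := ae_le0_of_mean P _ IcM.
have -> : [set w | 0 < c w - M] = Y @^-1` A.
  by rewrite -AE; apply/seteqP; split => w /=; rewrite subr_gt0.
have S f : L1 P f -> P.-integrable (Y @^-1` A) (EFin \o f).
  by apply: integrableS => //; exact: mpre.
have mYA := mpre _ mA.
rewrite mean_indic// RintegralB//; [|exact: S|exact: S (integrable_cst_fun _ _)].
rewrite cX// -RintegralB//; [|exact: S|exact: S (integrable_cst_fun _ _)].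
move=> H; apply: filterS (H _) => [w|]; first by rewrite subr_le0.
rewrite -oppr_ge0 -mulN1r -RintegralZl//; last exact: S.
by apply: Rintegral_ge0 => w _; rewrite mulN1r oppr_ge0 subr_le0.
Qed.

End conditional_expectation.

(** * Bounded size bias couplings *)

Section size_bias.
Context {d : measure_display} {T : measurableType d} {R : realType}.
Variables (P : probability T R) (Y X : T -> R) (mu B : R).

Hypothesis mY : measurable_fun setT Y.
Hypothesis mX : measurable_fun setT X.
Hypothesis XB : forall w, `|X w| <= B.
Hypothesis L1Y : L1 P Y.
Hypothesis L2Y : L1 P (fun w => Y w ^+ 2).
Hypothesis bias : forall (g : R -> R) M, continuous g ->
  (forall x, `|g x| <= M) ->
  mean P (fun w => Y w * g (Y w)) = mu * mean P (fun w => g (Y w + X w)).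

(** The identity function is not an admissible test function, but its
    truncations are; dominated convergence removes the truncation. *)
Lemma size_bias_second_moment :
  mean P (fun w => Y w ^+ 2) = mu * mean P (fun w => Y w + X w).
Proof.
have mYX : measurable_fun setT (fun w => Y w + X w) by exact: measurable_funD.
have C1 : mean P (fun w => Y w * clip n%:R (Y w)) @[n --> \oo] -->
    mean P (fun w => Y w ^+ 2).
  apply: (@mean_dominated_cvg _ _ _ P _ _ (fun w => Y w ^+ 2)) => //.
  - move=> n; apply: measurable_funM => //; apply: measurableT_comp => //.
    exact: measurable_clip.
  - exact: measurable_funX.
  - move=> w; rewrite expr2; apply: cvgMl_tmp; exact: cvg_clip.
  - move=> n w; rewrite normrM -real_normK ?num_real// expr2 ler_wpM2l//.
    exact: norm_clip_le_norm.
have C2 : mu * mean P (fun w => clip n%:R (Y w + X w)) @[n --> \oo] -->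
    mu * mean P (fun w => Y w + X w).
  apply: cvgMl_tmp.
  apply: (@mean_dominated_cvg _ _ _ P _ _ (fun w => `|Y w + X w|)) => //.
  - by move=> n; apply: measurableT_comp => //; exact: measurable_clip.
  - by move=> w; exact: cvg_clip.
  - apply: integrable_abs; apply: integrable_add => //.
    exact: (integrable_of_bounded _ _ _ mX XB).
  - by move=> n w; exact: norm_clip_le_norm.
have E n : mean P (fun w => Y w * clip n%:R (Y w)) =
    mu * mean P (fun w => clip n%:R (Y w + X w)).
  apply: (bias _ n%:R) => [|x]; first exact: continuous_clip.
  exact: norm_clip_le.
move: C1; rewrite (eq_cvg _ _ E) => C1.
by apply: (cvg_unique _ C1 C2); exact: Rhausdorff.
Qed.

End size_bias.

Section bounded_coupling.
Context {d : measure_display} {T : measurableType d} {R : realType}.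
Variables (P : probability T R) (Y : {RV P >-> R}) (X c : T -> R).
Variables (mu sigma B : R).

Hypothesis mX : measurable_fun setT X.
Hypothesis XB : forall w, `|X w| <= B.
Hypothesis L1Y : L1 P Y.
Hypothesis L2Y : L1 P (fun w => (Y w - mu) ^+ 2).
Hypothesis mu_ge0 : 0 <= mu.
Hypothesis EY : mean P Y = mu.
Hypothesis sigma_gt0 : 0 < sigma.
Hypothesis VY : mean P (fun w => (Y w - mu) ^+ 2) = sigma ^+ 2.
Hypothesis bias : forall (g : R -> R) (M : R), continuous g ->
  (forall x, `|g x| <= M) ->
  mean P (fun w => Y w * g (Y w)) = mu * mean P (fun w => g (Y w + X w)).
Hypothesis L1c : L1 P c.
Hypothesis cX : forall A : set R, measurable A ->
  \int[P]_(w in Y @^-1` A) c w = \int[P]_(w in Y @^-1` A) X w.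
Hypothesis c_sigmaY : forall S : set R, measurable S ->
  exists2 A : set R, measurable A & c @^-1` S = Y @^-1` A.

Let mY : measurable_fun setT Y. Proof. exact: measurable_funPT. Qed.
Let L1X : L1 P X. Proof. exact: (integrable_of_bounded _ _ _ mX XB). Qed.
Let s0 : sigma != 0. Proof. by rewrite gt_eqF. Qed.

Let second_moment : L1 P (fun w => Y w ^+ 2) /\
  mean P (fun w => Y w ^+ 2) = sigma ^+ 2 + mu ^+ 2.
Proof.
have E : (fun w => Y w ^+ 2) =
    (fun w => (Y w - mu) ^+ 2 + (2 * mu * Y w - mu ^+ 2)).
  by apply/funext => w; ring.
have I2 : L1 P (fun w => 2 * mu * Y w - mu ^+ 2).
  by apply: integrable_sub; [exact: integrable_scale|exact: integrable_cst_fun].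
rewrite E; split; first exact: integrable_add.
rewrite RintegralD// VY RintegralB//; [|exact: integrable_scale|exact: integrable_cst_fun].
by rewrite RintegralZl// EY mean_cst; ring.
Qed.

Let mean_shift : mu * mean P X = sigma ^+ 2.
Proof.
have [L2 E] := second_moment.
have := size_bias_second_moment P Y X mu B mY mX XB L1Y L2 bias.
by rewrite E RintegralD// EY; lra.
Qed.

Let mu_gt0 : 0 < mu.
Proof.
rewrite lt_neqAle mu_ge0 andbT; apply/eqP => mu0.
have := mean_shift; rewrite -mu0 mul0r => /esym/eqP.
by rewrite expf_eq0/= (negbTE s0).
Qed.

(** The conditional mean inherits almost surely the bound on [X], hence has a
    finite variance; otherwise [std_dev P c] would be meaningless. *)
Let c_dev : mean P (fun w => `|c w - mean P c|) <= std_dev P c.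
Proof.
have /measurable_EFinP mc := measurable_int _ L1c.
have Ic : L1 P (fun w => c w - mean P c).
  by apply: integrable_sub => //; exact: integrable_cst_fun.
rewrite std_devE; apply: mean_norm_le_sqrt => //.
apply: (@integrable_sqr_ae_bounded _ _ _ _ _ (B + `|mean P c|)).
  exact: measurable_funB.
have up : \forall w \ae P, c w <= B.
  apply: (cond_ae_le P Y X c mY L1X L1c cX B) => [w|].
    by apply: le_trans (XB w); exact: ler_norm.
  have [A mA AE] := c_sigmaY `]B, +oo[ (measurable_itv _).
  by exists A => //; rewrite -AE; apply/seteqP; split => w /=; rewrite in_itv/= andbT.
have lo : \forall w \ae P, -1 * c w <= B.
  apply: (cond_ae_le P Y (fun w => -1 * X w) (fun w => -1 * c w) mY).
  - exact: integrable_scale.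
  - exact: integrable_scale.
  - move=> A mA; have mYA : measurable (Y @^-1` A).
      by rewrite -[X in measurable X]setTI; exact: mY.
    by rewrite !RintegralZl ?cX//; exact: (integrableS measurableT).
  - by move=> w; rewrite mulN1r; apply: le_trans (XB w); rewrite lerNl; exact: lerNnormlW.
  have [A mA AE] := c_sigmaY `]-oo, - B[ (measurable_itv _).
  by exists A => //; rewrite -AE; apply/seteqP; split => w /=;
    rewrite in_itv/= mulN1r ltrNr.
apply: filterS2 up lo => w cB; rewrite mulN1r => Bc.
apply: (le_trans (ler_normB _ _)); rewrite lerD2r ler_norml cB andbT; lra.
Qed.

Lemma bounded_coupling_bound (D t a : R) : 0 < a ->
  (forall s, `|fine (P [set w | (Y w - mu) / sigma <= s]) - gPhi s| <= D) ->
  `|fine (P [set w | (Y w - mu) / sigma <= t]) - gPhi t| <=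
  a / 2 + mu / sigma * (std_dev P c / sigma + (B / sigma) ^+ 2 / 2 *
    (2 + (2 * D + (a + 2 * (B / sigma)) / 2) / a)).
Proof.
move=> a0 HD.
pose W w := (Y w - mu) / sigma; pose U w := X w / sigma.
pose c' w := c w / sigma.
have mW : measurable_fun setT W.
  by apply: measurable_funM => //; exact: measurable_funB.
have si0 : 0 <= sigma^-1 by rewrite invr_ge0 ltW.
have WU w : W w + U w = (Y w + X w - mu) / sigma by rewrite /W /U; field.
have B0 : 0 <= B by apply: le_trans (XB point).
have Z f : L1 P f -> L1 P (fun w => f w / sigma).
  move=> If; rewrite (_ : (fun w => _) = (fun w => sigma^-1 * f w)).
    exact: integrable_scale.
  by apply/funext => w; rewrite mulrC.
have EZ f : L1 P f -> mean P (fun w => f w / sigma) = mean P f / sigma.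
  by move=> If; rewrite RintegralZr.
apply: (@core_bound _ _ _ P W U c' (mu / sigma) (B / sigma) D
  (std_dev P c / sigma)) => //.
- by apply: measurable_funM.
- exact: Z.
- by rewrite divr_ge0// ltW.
- by rewrite divr_ge0// ltW.
- by move=> w; rewrite /U normrM (ger0_norm si0) ler_wpM2r.
- rewrite (_ : (fun w => _) = (fun w => sigma ^- 2 * (Y w - mu) ^+ 2)).
    exact: integrable_scale.
  by apply/funext => w; rewrite /W; field.
- have -> : mean P (fun w => W w ^+ 2) = mean P (fun w => sigma ^- 2 * (Y w - mu) ^+ 2).
    by apply: eq_Rintegral => w _; rewrite /W; field.
  by rewrite RintegralZl// VY mulVf// expf_neq0.
- move=> f cf f1; have mf : measurable_fun setT f by exact: continuous_measurable_fun.
  have := bias (fun y : R => f ((y - mu) / sigma)) 1.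
  have IYf : L1 P (fun w => Y w * f (W w)).
    apply: (@integrable_mul_bounded _ _ _ _ _ _ 1) => //; exact: measurableT_comp.
  have If : L1 P (fun w => f (W w)).
    apply: (@integrable_of_bounded _ _ _ _ _ 1) => //; exact: measurableT_comp.
  have -> : mean P (fun w => W w * f (W w)) =
      mean P (fun w => (Y w * f (W w) - mu * f (W w)) / sigma).
    by apply: eq_Rintegral => w _; rewrite /W; field.
  rewrite EZ; last by apply: integrable_sub => //; exact: integrable_scale.
  rewrite RintegralB//; last exact: integrable_scale.
  rewrite RintegralZl// => ->//.
    under [X in _ = _ * (X - _)]eq_Rintegral do rewrite WU.
    by rewrite /W; field.
  move=> x; apply: (@continuous_comp _ _ _ (fun y => (y - mu) / sigma) f);
    last exact: cf.
  by apply: cvgM; [apply: cvgB; [exact: cvg_id|exact: cvg_cst]|exact: cvg_cst].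
- move=> f cf f1; have mf : measurable_fun setT f by exact: continuous_measurable_fun.
  have mg : measurable_fun setT (fun y : R => f ((y - mu) / sigma)).
    by apply: measurableT_comp => //; apply: measurable_funM => //; exact: measurable_funB.
  have := cond_mean_mul P Y X c mY L1X L1c cX _ mg (fun=> f1 _).
  have e g : mean P (fun w => g w / sigma * f (W w)) =
      mean P (fun w => (g w * f (W w)) / sigma).
    by apply: eq_Rintegral => w _; rewrite mulrAC.
  move=> E; rewrite /U /c' !e !EZ ?E//.
  + by apply: (@integrable_mul_bounded _ _ _ _ _ _ 1) => //; exact: measurableT_comp.
  + by apply: (@integrable_mul_bounded _ _ _ _ _ _ 1) => //; exact: measurableT_comp.
- rewrite /U EZ// mulrACA mean_shift -invfM -expr2 mulfV// expf_neq0//.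
- rewrite /c' EZ//.
  have -> : mean P (fun w => `|c w / sigma - mean P c / sigma|) =
      mean P (fun w => `|c w - mean P c| / sigma).
    by apply: eq_Rintegral => w _; rewrite -mulrBl normrM (ger0_norm si0).
  rewrite EZ ?ler_wpM2r//.
  by apply: integrable_abs; apply: integrable_sub => //; exact: integrable_cst_fun.
Qed.

(** The mean of [X] is [sigma ^+ 2 / mu], and cannot exceed [B]. *)
Lemma size_bias_gap : 1 <= mu / sigma * (B / sigma).
Proof.
rewrite mulrACA -invfM -expr2 ler_pdivlMr ?exprn_gt0// mul1r -mean_shift.
rewrite ler_pM2l// -[leRHS](mean_cst P); apply: mean_le => //.
  exact: integrable_cst_fun.
by move=> w; apply: le_trans (XB w); exact: ler_norm.
Qed.

End bounded_coupling.

(** * The Kolmogorov bound *)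

Lemma smoothing_optimum {R : realType} (D lam b A p q : R) :
  0 <= lam -> 0 <= b -> 1 <= lam * b -> 0 <= p -> 0 <= q -> 0 <= A ->
  p ^+ 2 = A + 11 / 5 * (lam * b ^+ 2) -> q ^+ 2 = 4 / 5 * (lam * b ^+ 2) ->
  (forall a : R, 0 < a -> D <=
    a / 2 + (A + lam * (b ^+ 2 / 2 * (2 + (2 * D + (a + 2 * b) / 2) / a)))) ->
  D <= (p + q) ^+ 2.
Proof.
move=> lam0 b0 lb p0 q0 A0 pE qE H.
have bpos : 0 < b.
  by rewrite lt_neqAle b0 andbT; apply/eqP => b00; move: lb; rewrite -b00 mulr0; lra.
have [L LE] : {L | L = lam * b ^+ 2} by exists (lam * b ^+ 2).
rewrite -LE in pE qE.
have Lb : b <= L by rewrite LE expr2 mulrA ler_peMl.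
have L0 : 0 < L by apply: lt_le_trans Lb.
have qpos : 0 < q.
  rewrite lt_neqAle q0 andbT; apply/eqP => q00; move: qE; rewrite -q00 expr0n/=; lra.
have qp : q <= p.
  by rewrite -(@ler_pXn2r _ 2)// ?nnegrE// pE qE; lra.
have ppos : 0 < p by apply: lt_le_trans qp.
(* Minimising k / (k - 1) * (p ^ 2 - q ^ 2 + k q ^ 2) gives k - 1 = p / q;
   then p ^ 2 - q ^ 2 + k q ^ 2 = p (p + q). *)
have [k kE] : {k | k = (p + q) / q} by exists ((p + q) / q).
have k2 : 2 <= k by rewrite kE ler_pdivlMr//; lra.
have kpos : 0 < k by lra.
(* The width a = k L makes the coefficient of D on the right equal to 1 / k. *)
have := H (k * L) (mulr_gt0 kpos L0).
have -> : A + lam * (b ^+ 2 / 2 * (2 + (2 * D + (k * L + 2 * b) / 2) / (k * L))) =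
    A + 5 / 4 * L + D / k + b / (2 * k).
  have lam_neq0 : lam != 0 by apply/eqP => l0; move: L0; rewrite LE l0 mul0r ltxx.
  by rewrite LE; field; rewrite lam_neq0 !gt_eqF.
move=> HD.
have bk : b / (2 * k) <= L / 4.
  rewrite ler_pdivrMr ?mulr_gt0//.
  have : L * 2 <= L * k by rewrite ler_wpM2l// ltW.
  by lra.
have HD' : D * (1 - k^-1) <= A + 3 / 2 * L + k * L / 2 by lra.
have E : 1 - k^-1 = p / (p + q).
  by rewrite kE; field; rewrite !gt_eqF// addr_gt0.
have kL : L * k = 5 / 4 * q * (p + q).
  have -> : L = 5 / 4 * q ^+ 2 by rewrite qE; lra.
  by rewrite kE; field; rewrite gt_eqF.
have le1 : D * (p / (p + q)) <= p * (p + q).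
  by rewrite -E; apply: (le_trans HD'); nra.
by move: le1; rewrite mulrCA ler_pM2l// ler_pdivrMr ?addr_gt0.
Qed.

Theorem lemma3p1 (d : measure_display) (T : measurableType d) (R : realType)
    (P : probability T R) (Y Ys : {RV P >-> R}) (mu sigma B : R)
    (Y_ge0 : \forall w \ae P, 0 <= Y w)
    (meanY : 'E_P[Y]%E = mu%:E)
    (sigma_gt0 : 0 < sigma)
    (varY : 'V_P[Y]%E = (sigma ^+ 2)%:E)
    (Ys_size_biased : size_biased P P Y Ys)
    (B_gt0 : 0 < B)
    (Ys_bounded : P [set w | `|Ys w - Y w| <= B] = 1%E)
    (condE : T -> R)
    (condE_version : is_cond_expectation P (fun w => Ys w - Y w) Y condE) :
  let Delta := std_dev P condE in
  normal_distance P Y <=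
    mu / (5 * sigma ^+ 2) *
    (Num.sqrt (11 * B ^+ 2 / sigma + 5 * Delta) + 2 * B / Num.sqrt sigma) ^+ 2.
Proof.
cbv zeta; set Delta := std_dev P condE.
have s0 : sigma != 0 by rewrite gt_eqF.
have mY : measurable_fun setT Y by exact: measurable_funPT.
have mYs : measurable_fun setT Ys by exact: measurable_funPT.
have mD : measurable_fun setT (fun w => Ys w - Y w) by exact: measurable_funB.
have EY : fine 'E_P[Y]%E = mu by rewrite meanY.
have EY' : mean P Y = mu by rewrite -EY unlock.
have sdY : std_dev P Y = sigma.
  by rewrite /std_dev varY/= sqrtr_sqr gtr0_norm.
have VY : mean P (fun w => (Y w - mu) ^+ 2) = sigma ^+ 2.
  have := std_devE P Y; rewrite EY' sdY => ->.
  rewrite sqr_sqrtr//; apply: Rintegral_ge0 => w _; exact: sqr_ge0.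
have L2Y : L1 P (fun w => (Y w - mu) ^+ 2).
  apply/integrableP; split.
    by apply/measurable_EFinP; apply: measurable_funX; exact: measurable_funB.
  under eq_integral do rewrite /= ger0_norm ?sqr_ge0//.
  move: varY; rewrite /variance covariance.unlock EY unlock => E.
  have -> : (\int[P]_w ((Y w - mu) ^+ 2)%:E = (sigma ^+ 2)%:E)%E.
    by rewrite -E; apply: eq_integral => w _; rewrite expr2.
  exact: ltry.
have L1Y : L1 P Y.
  apply: (@integrable_dominated _ _ _ _ _ (fun w => (1 + `|mu|) + (Y w - mu) ^+ 2)) => //.
  - move=> w; have := ler_normD (Y w - mu) mu; rewrite subrK.
    have := sqr_ge0 (`|Y w - mu| - 2^-1).
    by rewrite -(@real_normK _ (Y w - mu)) ?num_real//; lra.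
  - by apply: integrable_add => //; exact: integrable_cst_fun.
have mu_ge0 : 0 <= mu.
  rewrite -EY' (_ : mean P Y = mean P (fun w => `|Y w|)).
    exact: Rintegral_ge0.
  apply: mean_ae_eq => //; first exact: measurableT_comp.
  by apply: filterS Y_ge0 => w Yw; rewrite ger0_norm.
(* Clipping changes Ys - Y on a null set only, and makes the bound by B hold
   everywhere. *)
pose X w := clip B (Ys w - Y w).
have mX : measurable_fun setT X.
  by apply: measurableT_comp => //; exact: measurable_clip.
have XB w : `|X w| <= B by apply: norm_clip_le; exact: ltW.
have X_ae : \forall w \ae P, X w = Ys w - Y w.
  have mE : measurable [set w | `|Ys w - Y w| <= B].
    rewrite (_ : [set w | _] = setT `&` (fun w => `|Ys w - Y w|) @^-1` `]-oo, B]).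
      have : measurable_fun setT (fun w => `|Ys w - Y w|) by exact: measurableT_comp.
      by apply.
    by rewrite setTI; apply/seteqP; split => w /=; rewrite in_itv.
  exists (~` [set w | `|Ys w - Y w| <= B]); split.
  - exact: measurableC.
  - by rewrite probability_setC// Ys_bounded subee.
  - by move=> w /=; apply: contra_not => /clip_id.
have bias (g : R -> R) (M : R) : continuous g -> (forall x, `|g x| <= M) ->
    mean P (fun w => Y w * g (Y w)) =
    mu * mean P (fun w => g (Y w + X w)).
  move=> cg gM.
  have mg : measurable_fun setT g by exact: continuous_measurable_fun.
  have bg : bounded_fun g.
    exists M; split; first exact: num_real.
    by move=> x Mx y _; exact: le_trans (gM y) (ltW Mx).
  have Ig : L1 P (fun w => g (Ys w)).
    by apply: (@integrable_of_bounded _ _ _ _ _ M) => //; exact: measurableT_comp.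
  have := congr1 fine (Ys_size_biased g cg bg).
  rewrite meanY !unlock fineM//; last exact: (integrable_fin_num measurableT Ig).
  rewrite -!/(Rintegral _ _ _) /= => ->; congr (_ * _).
  apply: mean_ae_eq; [exact: measurableT_comp| |].
    by apply: measurableT_comp => //; exact: measurable_funD.
  by apply: filterS X_ae => w ->; rewrite addrC subrK.
have [mc L1c cD] := condE_version.
have cX (A : set R) : measurable A ->
    \int[P]_(w in Y @^-1` A) condE w = \int[P]_(w in Y @^-1` A) X w.
  move=> mA; have mYA : measurable (Y @^-1` A).
    by rewrite -[X in measurable X]setTI; exact: mY.
  rewrite /Rintegral; congr fine; rewrite cD; last first.
    by exists A => //; rewrite setTI.
  apply: ae_eq_integral => //.
  - by apply/measurable_EFinP; apply: measurable_funTS.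
  - by apply/measurable_EFinP; apply: measurable_funTS.
  - by apply: filterS X_ae => w -> _.
have c_sigmaY (S : set R) : measurable S ->
    exists2 A : set R, measurable A & condE @^-1` S = Y @^-1` A.
  by move=> mS; have [A mA] := mc measurableT _ mS; rewrite !setTI => <-; exists A.
have := @bounded_coupling_bound _ _ _ P Y X condE mu sigma B mX XB L1Y L2Y
  mu_ge0 EY' sigma_gt0 VY bias L1c cX c_sigmaY.
have := @size_bias_gap _ _ _ P Y X mu sigma B mX XB L1Y L2Y
  mu_ge0 EY' sigma_gt0 VY bias.
move=> gap core.
rewrite /normal_distance EY sdY.
set D := sup _.
have D_ub s : `|fine (P [set w | (Y w - mu) / sigma <= s]) - gPhi s| <= D.
  apply: ub_le_sup; last by exists s.
  exists 1 => _ [r _ <-].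
  have mW : measurable [set w | (Y w - mu) / sigma <= r].
    rewrite -[X in measurable X]setTI; apply: measurable_fun_le => //.
    by apply: measurable_funM => //; exact: measurable_funB.
  have F0 : 0 <= fine (P [set w | (Y w - mu) / sigma <= r]) <= 1.
    by rewrite fine_ge0//= -lee_fin fineK ?fin_num_measure// probability_le1.
  by have := gPhi_ge0 r; have := gPhi_le1 r; rewrite ler_norml /gPhi; lra.
have bound a : 0 < a -> D <= a / 2 + (mu / sigma * (Delta / sigma) +
    mu / sigma * ((B / sigma) ^+ 2 / 2 *
      (2 + (2 * D + (a + 2 * (B / sigma)) / 2) / a))).
  move=> a0; rewrite -mulrDr; apply: ge_sup.
    by exists (`|fine (P [set w | (Y w - mu) / sigma <= 0]) - gPhi 0|), 0.
  by move=> _ [t _ <-]; exact: core.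
pose k := mu / (5 * sigma ^+ 2).
have D0 : 0 <= Delta by exact: sqrtr_ge0.
have k0 : 0 <= k by rewrite divr_ge0// mulr_ge0// sqr_ge0.
have ss : Num.sqrt sigma ^+ 2 = sigma by rewrite sqr_sqrtr// ltW.
have ss0 : Num.sqrt sigma != 0 by rewrite gt_eqF// sqrtr_gt0.
pose r := 11 * B ^+ 2 / sigma + 5 * Delta.
have r0 : 0 <= r.
  rewrite addr_ge0//; last by rewrite mulr_ge0.
  by rewrite divr_ge0 ?ltW// mulr_gt0// exprn_gt0.
rewrite -/k -/r.
have -> : k * (Num.sqrt r + 2 * B / Num.sqrt sigma) ^+ 2 =
    (Num.sqrt k * Num.sqrt r + Num.sqrt k * (2 * B / Num.sqrt sigma)) ^+ 2.
  by rewrite -mulrDr exprMn sqr_sqrtr.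
apply: (@smoothing_optimum R D (mu / sigma) (B / sigma)
  (mu / sigma * (Delta / sigma))) => //.
- by rewrite divr_ge0// ltW.
- by rewrite divr_ge0// ltW.
- by rewrite mulr_ge0 ?sqrtr_ge0// divr_ge0 ?sqrtr_ge0// mulr_ge0// ltW.
- by rewrite mulr_ge0// divr_ge0// ltW.
- by rewrite exprMn !sqr_sqrtr// /k /r; field.
- rewrite exprMn sqr_sqrtr// exprMn exprVn ss /k; field.
  exact: s0.
Qed.
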